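(* Let $A,B$ be topped PCMs and let $\phi:A\to B$ be an invertible morphism with separating relation $\perp_\phi$. For $b\in B$ let $F(b)$ be the predicate on states over $A$ given by $F(b)(s):\Leftrightarrow \phi(s_{\mathtt s})=b\wedge s_{\mathtt s}\perp_\phi s_{\mathtt o}$. Then for all $b_1,b_2\in B$ and every state $s$, $F(b_1\bullet b_2)(s)\Leftrightarrow (F(b_1)\ast F(b_2))(s)$.
   Context: A topped PCM is a tuple $(A,\bullet,\mathbb{1},\top,D)$ where $\bullet$ is a total commutative associative binary operation on $A$ with unit $\mathbb{1}$, $\top\in A$, and $D\subseteq A$ (the defined elements) satisfy: $\top\notin D$; $\mathbb{1}\in D$; if $x\bullet y\in D$ then $x,y\in D$; $x\bullet\top=\top\bullet x=\top$. Write $x\perp y$ for $x\bullet y\in D$. A relation $R$ on $A$ is a separating relation if: (1) $x\,R\,y$ implies $x\,R\,\mathbb{1}$; (2) $x\,R\,y$ implies $x\perp y$; (3) $\mathbb{1}\,R\,\mathbb{1}$; (4) $x\,R\,y$ iff $y\,R\,x$; (5) $x\,R\,y$ and $(x\bullet y)\,R\,z$ imply $x\,R\,(y\bullet z)$ and $y\,R\,z$. A separating relation $R$ is invertible if for all $a_1,a_2,a'$ with $a_1\,R\,(a_2\bullet a')$ and $a_2\,R\,(a_1\bullet a')$ one has $a_1\,R\,a_2$ and $(a_1\bullet a_2)\,R\,a'$. A morphism $\phi:A\to B$ of topped PCMs with separating relation $\perp_\phi$ on $A$ is a function such that $\phi(\mathbb{1}_A)=\mathbb{1}_B$, $\phi(\top_A)=\top_B$,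 and $x\perp_\phi y$ implies $\phi(x)\perp\phi(y)$ and $\phi(x\bullet y)=\phi(x)\bullet\phi(y)$. A morphism $\phi:A\to B$ is invertible if $\perp_\phi$ is an invertible separating relation and for all $a\in A$ with $a\perp_\phi\mathbb{1}$ and all $b_1,b_2\in B$ with $\phi(a)=b_1\bullet b_2$ there exist $a_1,a_2\in A$ with $a=a_1\bullet a_2$, $a_1\perp_\phi a_2$, $\phi(a_1)=b_1$, $\phi(a_2)=b_2$. A state over $A$ is a pair $s=(s_{\mathtt s},s_{\mathtt o})\in A\times A$ with $s_{\mathtt s}\perp s_{\mathtt o}$. For states $s,s_1,s_2$, write $s=s_1\star s_2$ if there are $a_1,a_2,a'\in A$ with $s=(a_1\bullet a_2,a')$, $s_1=(a_1,a_2\bullet a')$, $s_2=(a_2,a_1\bullet a')$. For predicates $P,Q$ on states, $(P\ast Q)(s):\Leftrightarrow\exists s_1,s_2.\ s=s_1\star s_2\wedge P(s_1)\wedge Q(s_2)$. *)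

(* Defs.v *)
From mathcomp Require Import ssreflect ssrfun ssrbool.

Set Implicit Arguments.
Unset Strict Implicit.
Unset Printing Implicit Defensive.

Declare Scope pcm_scope.
Delimit Scope pcm_scope with pcm.

Record tpcm : Type := TPCM {
  carrier :> Type;
  pmul : carrier -> carrier -> carrier;
  pone : carrier;
  ptop : carrier;
  defined : carrier -> Prop;
  pmul_assoc : associative pmul;
  pmul_comm : commutative pmul;
  pmul_unitl : left_id pone pmul;
  pmul_unitr : right_id pone pmul;
  ptop_undefined : ~ defined ptop;
  pone_defined : defined pone;
  pmul_defined : forall x y, defined (pmul x y) -> defined x /\ defined y;
  pmul_topl : left_zero ptop pmul;
  pmul_topr : right_zero ptop pmul
}.

Arguments pone {t}.
Arguments ptop {t}.

Notation "x ** y" := (pmul x y) (at level 40, left associativity) : pcm_scope.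
Local Open Scope pcm_scope.

Definition disjoint (A : tpcm) (x y : A) : Prop := defined (x ** y).

Record separating (A : tpcm) (R : A -> A -> Prop) : Prop := Separating {
  sep_unit : forall x y, R x y -> R x pone;
  sep_disjoint : forall x y, R x y -> disjoint x y;
  sep_unit_unit : R pone pone;
  sep_sym : forall x y, R x y <-> R y x;
  sep_assoc : forall x y z, R x y -> R (x ** y) z -> R x (y ** z) /\ R y z
}.

Definition invertible_rel (A : tpcm) (R : A -> A -> Prop) : Prop :=
  forall a1 a2 a' : A, R a1 (a2 ** a') -> R a2 (a1 ** a') ->
    R a1 a2 /\ R (a1 ** a2) a'.

Record morphism (A B : tpcm) : Type := Morphism {
  morph_fun :> A -> B;
  morph_sep : A -> A -> Prop;
  morph_separating : separating morph_sep;
  morph_unit : morph_fun pone = pone;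
  morph_top : morph_fun ptop = ptop;
  morph_op : forall x y, morph_sep x y ->
    disjoint (morph_fun x) (morph_fun y) /\
    morph_fun (x ** y) = morph_fun x ** morph_fun y
}.

Definition invertible (A B : tpcm) (phi : morphism A B) : Prop :=
  invertible_rel (morph_sep phi) /\
  forall (a : A) (b1 b2 : B), morph_sep phi a pone -> phi a = b1 ** b2 ->
    exists a1 a2 : A,
      [/\ a = a1 ** a2, morph_sep phi a1 a2, phi a1 = b1 & phi a2 = b2].

Record state (A : tpcm) : Type := State {
  state_pair : A * A;
  state_disjoint : disjoint state_pair.1 state_pair.2
}.

Definition self (A : tpcm) (s : state A) : A := (state_pair s).1.
Definition other (A : tpcm) (s : state A) : A := (state_pair s).2.

(* The relation s = s1 \star s2.  States are compared through their underlying
   pairs, so that no proof irrelevance is needed. *)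
Definition state_split (A : tpcm) (s s1 s2 : state A) : Prop :=
  exists a1 a2 a' : A,
    [/\ state_pair s = (a1 ** a2, a'),
        state_pair s1 = (a1, a2 ** a')
      & state_pair s2 = (a2, a1 ** a')].

Definition sepconj (A : tpcm) (P Q : state A -> Prop) (s : state A) : Prop :=
  exists s1 s2 : state A, [/\ state_split s s1 s2, P s1 & Q s2].

Definition fiber (A B : tpcm) (phi : morphism A B) (b : B) (s : state A) :
    Prop :=
  phi (self s) = b /\ morph_sep phi (self s) (other s).

(* Main.v *)
Require Import Defs.
From mathcomp Require Import ssreflect ssrfun ssrbool.

Set Implicit Arguments.
Unset Strict Implicit.
Unset Printing Implicit Defensive.

Local Open Scope pcm_scope.

(** Each half of invertibility serves one direction. Lifting a factorisation of [phi a] yields the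
    parts [a1], [a2], and [sep_assoc] passes separateness from the whole to each part. Conversely,
    invertibility of the relation recombines the parts, on whose product [phi] is multiplicative. *)

Theorem lemma4p13 (A B : tpcm) (phi : morphism A B) (hphi : invertible phi)
    (b1 b2 : B) (s : state A) :
  fiber phi (b1 ** b2) s <-> sepconj (fiber phi b1) (fiber phi b2) s.
Proof.
case: hphi => inv_sep lift; have sepP := morph_separating phi.
rewrite /sepconj /fiber /self /other; split.
- case: s => [[a a'] disj_s] /= [phi_a sep_aa'].
  have [a1 [a2 [def_a sep12 phi1 phi2]]] :=
    lift _ _ _ (sep_unit sepP sep_aa') phi_a.
  rewrite def_a in sep_aa'.
  have [sep1 _] := sep_assoc sepP sep12 sep_aa'.
  (* [sep_assoc] moves only the right factor across, so [a2] needs the factors swapped. *)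
  have sep21 : morph_sep phi a2 a1 by apply/(sep_sym sepP).
  rewrite pmul_comm in sep_aa'.
  have [sep2 _] := sep_assoc sepP sep21 sep_aa'.
  (* Separateness implies disjointness, so both pairs are states. *)
  exists (@State A (a1, a2 ** a') (sep_disjoint sepP sep1)).
  exists (@State A (a2, a1 ** a') (sep_disjoint sepP sep2)).
  by split=> //; exists a1, a2, a'; split; rewrite /= -?def_a.
- case=> s1 [s2 [[a1 [a2 [a' [-> -> ->]]]] /= [phi1 sep1] [phi2 sep2]]].
  (* Each part is separate from the other part joined with the frame [a'], exactly the premises of
     [invertible_rel]. *)
  have [sep12 sep_aa'] := inv_sep _ _ _ sep1 sep2.
  by have [_ ->] := morph_op sep12; rewrite phi1 phi2.
Qed.
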